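(* The class of unital open quantal frames coincides with the class of inverse quantal frames.
   Context: A quantale is a sup-lattice with an associative multiplication preserving joins in each variable; it is unital if the multiplication has a unit $e$. An involutive quantal frame $Q$ is a quantale with a join-preserving involution ($a^{**}=a$, $(ab)^*=b^*a^*$) whose underlying lattice is a frame; $1$ is its top. $R(Q)=\{a\in Q:a1\le a\}$. An involutive quantal frame $Q$ is balanced if $b(a1\wedge c)=(b\wedge 1a^* )c$ for all $a,b,c\in Q$. Put $\upsilon(a)=\bigvee_{xy^*\le a}x\wedge y$. An open quantal frame is a balanced quantal frame $Q$ such that $\upsilon(Q)\subset R(Q)$; $\bigvee_{xx^*x\le a}x=a$ for all $a\in Q$; and $(a1\wedge b)c=a1\wedge bc$ for all $a,b,c\in Q$. A unital open quantal frame is an open quantal frame with a multiplicative unit $e$. A support on a unital involutive quantale is a join-preserving map $\varsigma:Q\to Q$ with $\varsigma(a)\le e$, $\varsigma(a)\le aa^*$ and $a\le\varsigma(a)a$ for all $a$. A partial unit of $Q$ is an element $s$ with $ss^*\le e$ and $s^*s\le e$; $\mathcal I(Q)$ is the set of partial units. An inverse quantal frame is a unital involutive quantal frame $Q$ such that $\bigvee\mathcal I(Q)=1$ and for which there exists a support (which is then necessarily unique and stable, i.e. $\varsigma(ab)=\varsigma(a\varsigma(b))$). *)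

(* Defs.v *)
From HB Require Import structures.
From mathcomp Require Import all_boot all_order.
From mathcomp Require Import boolp classical_sets.

Set Implicit Arguments.
Unset Strict Implicit.
Unset Printing Implicit Defensive.

Import Order.Theory.
Local Open Scope classical_set_scope.
Local Open Scope group_scope.
Local Open Scope order_scope.

(* The library's [tbLatticeType] supplies the order, the binary meet and join,
   and the top and bottom elements.  Since these are all determined by the order
   as soon as arbitrary joins exist, starting from it costs no generality. *)
HB.mixin Record isSupLattice d T of Order.TBLattice d T := {
  bigjoin : set T -> T;
  bigjoinP : forall A : set T, supremums A (bigjoin A)
}.

#[short(type="supLatticeType")]
HB.structure Definition SupLattice d :=
  {T of Order.TBLattice d T & isSupLattice d T}.

Definition join_preserving d d' (T : supLatticeType d) (T' : supLatticeType d')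
    (f : T -> T') :=
  forall A : set T, f (bigjoin A) = bigjoin (f @` A).

HB.mixin Record isFrame d T of SupLattice d T := {
  meet_bigjoin : forall a : T, join_preserving (Order.meet a)
}.

#[short(type="frameType")]
HB.structure Definition Frame d := {T of SupLattice d T & isFrame d T}.

HB.mixin Record isQuantale d T of SupLattice d T & Semigroup T := {
  mulg_bigjoinr : forall a : T, join_preserving (fun b : T => a * b);
  mulg_bigjoinl : forall b : T, join_preserving (fun a : T => a * b)
}.

#[short(type="quantaleType")]
HB.structure Definition Quantale d :=
  {T of SupLattice d T & Semigroup T & isQuantale d T}.

HB.mixin Record isInvolutive d T of Quantale d T := {
  star : T -> T;
  starK : involutive star;
  starM : forall a b : T, star (a * b) = star b * star a;
  star_bigjoin : join_preserving star
}.

#[short(type="involutiveQuantaleType")]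
HB.structure Definition InvolutiveQuantale d :=
  {T of Quantale d T & isInvolutive d T}.

#[short(type="involutiveQuantalFrameType")]
HB.structure Definition InvolutiveQuantalFrame d :=
  {T of InvolutiveQuantale d T & Frame d T}.

Notation "x ^*" := (star x) : order_scope.

(* Multiplicative units are a property, not a structure: a unit is unique when
   it exists.  The "1" of the source is the top element, here [\top]. *)
Definition is_unit (M : semigroupType) (e : M) :=
  left_id e (@mul M) /\ right_id e (@mul M).

Definition unital (M : semigroupType) := exists e : M, is_unit e.

Section InvolutiveQuantales.
Context {d : Order.disp_t} {Q : involutiveQuantaleType d}.

Definition right_sided : set Q := [set a | a * \top <= a].

Definition is_support (e : Q) (s : Q -> Q) :=
  [/\ join_preserving s,
      forall a, s a <= e,
      forall a, s a <= a * a^* &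
      forall a, a <= s a * a].

Definition partial_units (e : Q) : set Q :=
  [set s | s * s^* <= e /\ s^* * s <= e].

Definition upsilon (a : Q) : Q :=
  bigjoin [set z | exists x y : Q, x * y^* <= a /\ z = x `&` y].

End InvolutiveQuantales.

Section Classes.
Context {d : Order.disp_t}.
Implicit Type Q : involutiveQuantalFrameType d.

Definition balanced Q :=
  forall a b c : Q, b * (a * \top `&` c) = (b `&` \top * a^*) * c.

Definition open_quantal_frame Q :=
  [/\ balanced Q,
      forall a : Q, right_sided (upsilon a),
      forall a : Q, bigjoin [set x : Q | x * x^* * x <= a] = a &
      forall a b c : Q, (a * \top `&` b) * c = a * \top `&` b * c].

Definition unital_open_quantal_frame Q := open_quantal_frame Q /\ unital Q.

Definition inverse_quantal_frame Q :=
  exists e : Q, [/\ is_unit e, bigjoin (partial_units e) = \top &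
                    exists s : Q -> Q, is_support e s].

End Classes.

(* Main.v *)
Require Import Defs.
From mathcomp Require Import all_boot all_order.
From mathcomp Require Import classical_sets.

Set Implicit Arguments.
Unset Strict Implicit.
Unset Printing Implicit Defensive.

Import Order.Theory.
Local Open Scope classical_set_scope.
Local Open Scope group_scope.
Local Open Scope order_scope.

(** Write 1 for the top, [/\] for the meet and [e] for the unit.  Both classes
    satisfy [x <= x x^* x] ([regular_of_bigjoin], [support_regular]).
    Consequently every [z <= e] satisfies [z <= z z^*] and is self-adjoint:
    the elements below [e] behave like the open sets of the space of units of
    a groupoid.

    From open to inverse: the support is [a |-> e /\ a 1].  For the bound
    [e /\ a 1 <= b] where [b = a a^*], right-sidedness of [upsilon b], which
    lies above [a], gives [a 1 <= upsilon b], and [e /\ upsilon b <= b]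
    ([meet_upsilon_unit]).  The same right-sidedness applied to [upsilon e]
    shows that the elements [z] with [z z^* <= e] cover the top; meeting this
    cover with its image under the involution gives a cover by partial units.

    From inverse to open: partial units are closed downwards, so by frame
    distributivity every element is a join of partial units.  A partial unit
    [t] satisfies [t t^* t <= t], whence the condition on [x x^* x], and
    multiplying [x] and [y] on the right by [t] does not increase [x y^*],
    whence right-sidedness of [upsilon].  The key identity is
    [a 1 /\ b = s(a) b] for the support [s] ([meet_mul_top]): it turns
    [(a 1 /\ b) c = a 1 /\ b c] and the balance condition into
    associativity of the multiplication. *)

(** * Joins and order *)

Section Joins.
Context {d : Order.disp_t} {T : supLatticeType d}.
Implicit Types (a b : T) (A : set T).

Lemma le_bigjoin A a : A a -> a <= bigjoin A.
Proof. by case: (bigjoinP A) => ubA _; exact: ubA. Qed.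

Lemma bigjoin_le A b : (forall a, A a -> a <= b) -> bigjoin A <= b.
Proof. by case: (bigjoinP A) => _ lubA leAb; exact: lubA. Qed.

Lemma bigjoin_pair a b : a <= b -> bigjoin [set a; b] = b.
Proof.
move=> leab; apply/le_anti/andP; split; last by apply: le_bigjoin; right.
by apply: bigjoin_le => c [-> | ->].
Qed.

End Joins.

Section JoinPreserving.
Context {d d' : Order.disp_t} {T : supLatticeType d} {T' : supLatticeType d'}.
Variable f : T -> T'.
Hypothesis f_join : join_preserving f.

Lemma join_preserving_le a b : a <= b -> f a <= f b.
Proof.
move=> leab; rewrite -[in leRHS](bigjoin_pair leab) f_join.
by apply: le_bigjoin; exists a => //; left.
Qed.

Lemma join_preserving_bigjoin_le (A : set T) (b : T') :
  (forall a, A a -> f a <= b) -> f (bigjoin A) <= b.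
Proof.
by move=> leAb; rewrite f_join; apply: bigjoin_le => _ [a Aa <-]; exact: leAb.
Qed.

End JoinPreserving.

Lemma join_preserving_comp {d d' d'' : Order.disp_t} {T : supLatticeType d}
    {T' : supLatticeType d'} {T'' : supLatticeType d''}
    (g : T' -> T'') (f : T -> T') :
  join_preserving g -> join_preserving f -> join_preserving (fun a => g (f a)).
Proof. by move=> gj fj A; rewrite fj gj image_comp. Qed.

(** Distributivity restricts a cover [A] of the top to a cover of [a], so that
    inequalities can be checked locally on [A]. *)
Lemma frame_cover_le {d : Order.disp_t} {T : frameType d} (A : set T) (a b : T) :
  bigjoin A = \top -> (forall c, A c -> a `&` c <= b) -> a <= b.
Proof.
move=> coverA leAb; rewrite -[a]meetx1 -coverA.
exact: (join_preserving_bigjoin_le (meet_bigjoin a)).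
Qed.

(** * Involutive quantales *)

Section Quantale.
Context {d : Order.disp_t} {Q : quantaleType d}.
Implicit Types a b c : Q.

Lemma mulg_le2l a b c : b <= c -> a * b <= a * c.
Proof. exact: (join_preserving_le (mulg_bigjoinr a)). Qed.

Lemma mulg_le2r c a b : a <= b -> a * c <= b * c.
Proof. exact: (join_preserving_le (mulg_bigjoinl c)). Qed.

Lemma mulg_le a b a' b' : a <= a' -> b <= b' -> a * b <= a' * b'.
Proof. by move=> lea leb; apply: le_trans (mulg_le2l _ leb) (mulg_le2r _ lea). Qed.

End Quantale.

Section Involution.
Context {d : Order.disp_t} {Q : involutiveQuantaleType d}.
Implicit Types a b e x y z : Q.

Lemma le_star a b : a <= b -> a^* <= b^*.
Proof. exact: (join_preserving_le star_bigjoin). Qed.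

Lemma le_starl a b : a <= b^* -> a^* <= b.
Proof. by move/le_star; rewrite starK. Qed.

Lemma star_top : (\top : Q)^* = \top.
Proof. by apply/le_anti; rewrite lex1 -[X in X <= _]starK le_star ?lex1. Qed.

Lemma star_meet a b : (a `&` b)^* = a^* `&` b^*.
Proof.
apply/le_anti/andP; split; first by rewrite lexI !le_star ?leIl ?leIr.
rewrite -[leLHS]starK le_star // lexI.
by apply/andP; split; apply: le_starl; rewrite ?leIl ?leIr.
Qed.

Lemma star_unit e : is_unit e -> e^* = e.
Proof.
move=> [mul1 mule]; have <- : e * e^* = e^* by exact: mul1.
by rewrite -{1}[e]starK -starM [e * e^*]mul1 starK.
Qed.

Lemma mul_le_unitl e z a : is_unit e -> z <= e -> z * a <= a.
Proof. by move=> [mul1 _] /(mulg_le2r a); rewrite (mul1 a). Qed.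

Lemma mul_le_unitr e z a : is_unit e -> z <= e -> a * z <= a.
Proof. by move=> [_ mule] /(mulg_le2l a); rewrite (mule a). Qed.

Lemma le_mul_top e a : is_unit e -> a <= a * \top.
Proof. by move=> [_ mule]; rewrite -[leLHS](mule a); apply/mulg_le2l/lex1. Qed.

Lemma le_unit_mul_star e z :
  is_unit e -> z <= z * z^* * z -> z <= e -> z <= z * z^*.
Proof. by move=> eU zreg lez; apply: le_trans zreg (mul_le_unitr _ eU lez). Qed.

(** From [z <= z z^* <= z^*], apply the involution to get the converse
    inequality. *)
Lemma le_unit_star e z :
  is_unit e -> z <= z * z^* * z -> z <= e -> z^* = z.
Proof.
move=> eU zreg lez.
have zs : z <= z^*.
  by apply: le_trans (le_unit_mul_star eU zreg lez) (mul_le_unitl _ eU lez).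
by apply/le_anti; rewrite zs andbT; exact: le_starl.
Qed.

Lemma le_upsilon a x y : x * y^* <= a -> x `&` y <= upsilon a.
Proof. by move=> xya; apply: le_bigjoin; exists x, y. Qed.

Lemma partial_units_down e s t : partial_units e s -> t <= s -> partial_units e t.
Proof.
move=> [sse ses] ts; split; [apply: le_trans sse | apply: le_trans ses];
by apply: mulg_le => //; exact: le_star.
Qed.

Lemma support_regular e s a : is_support e s -> a <= a * a^* * a.
Proof.
by move=> [_ _ s_star s_mul]; apply: le_trans (s_mul a) (mulg_le2r _ (s_star a)).
Qed.

End Involution.

(** * From open to inverse *)

Section OpenToInverse.
Context {d : Order.disp_t} {Q : involutiveQuantalFrameType d}.
Implicit Types a b x y : Q.

(** Each [x] is one of the elements whose join is [x x^* x]. *)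
Lemma regular_of_bigjoin :
  (forall a : Q, bigjoin [set x : Q | x * x^* * x <= a] = a) ->
  forall x : Q, x <= x * x^* * x.
Proof. by move=> axiom x; rewrite -[leRHS]axiom; apply: le_bigjoin => /=. Qed.

Variable e : Q.
Hypothesis e_unit : is_unit e.
Hypothesis upsilon_rs : forall a : Q, right_sided (upsilon a).

Lemma mul_top_le_upsilon a b : a * a^* <= b -> a * \top <= upsilon b.
Proof.
move=> /le_upsilon; rewrite meetxx => /(mulg_le2r \top) /le_trans; apply.
exact: upsilon_rs.
Qed.

(** A piece [z = e /\ x /\ y] with [x y^* <= b] satisfies
    [z <= z z^* <= x y^*], the first step because [z <= e]. *)
Lemma meet_upsilon_unit b :
  (forall x : Q, x <= x * x^* * x) -> e `&` upsilon b <= b.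
Proof.
move=> regular; apply: (join_preserving_bigjoin_le (meet_bigjoin e)).
move=> _ [x [y [xyb ->]]].
apply: le_trans (le_unit_mul_star e_unit (regular _) (leIl _ _)) _.
apply: le_trans xyb; apply: mulg_le; last apply: le_star.
  by apply: le_trans (leIr _ _) (leIl _ _).
by apply: le_trans (leIr _ _) (leIr _ _).
Qed.

Lemma meet_unit_is_support :
  (forall x : Q, x <= x * x^* * x) ->
  (forall a b c : Q, (a * \top `&` b) * c = a * \top `&` b * c) ->
  is_support e (fun a : Q => e `&` a * \top).
Proof.
move=> regular mul_meet; split=> [|a|a|a].
- exact: join_preserving_comp (meet_bigjoin e) (mulg_bigjoinl \top).
- exact: leIl.
- apply: le_trans (meet_upsilon_unit (a * a^*) regular).
  by apply: leI2 => //; exact: mul_top_le_upsilon.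
- by rewrite meetC mul_meet (e_unit.1 a) lexI lexx (le_mul_top _ e_unit).
Qed.

(** Since [upsilon e] is right-sided and above [e], it is the top; its pieces
    [z = x /\ y] satisfy [z z^* <= x y^* <= e].  So the conditions
    [z z^* <= e] and, by the involution, [z^* z <= e] each define a cover of
    the top, and the pairwise meets of the two covers are partial units. *)
Lemma bigjoin_partial_units : bigjoin (partial_units e) = \top.
Proof.
apply/eqP; rewrite -le1x.
have ue : \top <= upsilon e.
  rewrite -[leLHS](e_unit.1 \top); apply: mul_top_le_upsilon.
  by rewrite (star_unit e_unit) (e_unit.1 e).
have coverl : bigjoin [set z : Q | z * z^* <= e] = \top.
  apply/eqP; rewrite -le1x; apply: le_trans ue _.
  apply: bigjoin_le => _ [x [y [xye ->]]]; apply: le_bigjoin => /=.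
  by apply: le_trans xye; apply: mulg_le; rewrite ?leIl // le_star ?leIr.
have coverr : bigjoin [set z : Q | z^* * z <= e] = \top.
  rewrite -star_top -coverl star_bigjoin; congr bigjoin.
  rewrite eqEsubset; split=> [z zze | _ [z zze <-]] /=; last by rewrite starK.
  by exists z^*; rewrite /= starK.
apply: (frame_cover_le coverl) => z zze; rewrite meet1x.
apply: (frame_cover_le coverr) => w wwe.
apply: le_bigjoin; split; [apply: le_trans zze | apply: le_trans wwe];
  by apply: mulg_le; rewrite ?le_star // ?leIl ?leIr.
Qed.

End OpenToInverse.

(** * From inverse to open *)

Section InverseToOpen.
Context {d : Order.disp_t} {Q : involutiveQuantalFrameType d}.
Implicit Types a b c t x y : Q.
Variable e : Q.
Hypothesis e_unit : is_unit e.
Hypothesis coverI : bigjoin (partial_units e) = \top.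

Lemma partial_units_generate a b :
  (forall t, partial_units e t -> t <= a -> t <= b) -> a <= b.
Proof.
move=> leab; apply: (frame_cover_le coverI) => t It.
by apply: leab; rewrite ?leIl //; apply: partial_units_down It (leIr _ _).
Qed.

Lemma mul_top_le_of_partial_units a b :
  (forall t, partial_units e t -> a * t <= b) -> a * \top <= b.
Proof. by rewrite -coverI; apply: (join_preserving_bigjoin_le (mulg_bigjoinr a)). Qed.

Lemma mul_partial_unit_star x y t :
  partial_units e t -> (x * t) * (y * t)^* <= x * y^*.
Proof.
move=> [tte _]; rewrite starM mulgA -[x * t * _]mulgA; apply: mulg_le2r.
exact: mul_le_unitr e_unit tte.
Qed.

(** If [x y^* <= a] and [t] is a partial unit, then [x t] and [y t] again
    satisfy [(x t) (y t)^* <= a], and [(x /\ y) t] is below both. *)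
Lemma upsilon_right_sided a : right_sided (upsilon a).
Proof.
rewrite /right_sided /=; apply: (join_preserving_bigjoin_le (mulg_bigjoinl \top)).
move=> _ [x [y [xya ->]]]; apply: mul_top_le_of_partial_units => t It.
apply: le_trans (le_upsilon (le_trans (mul_partial_unit_star x y It) xya)).
by rewrite lexI !mulg_le2r ?leIl ?leIr.
Qed.

(** The partial units [t] below [a] already have join [a], and [t t^* t <= t]. *)
Lemma bigjoin_mul_star_mul a :
  (forall x : Q, x <= x * x^* * x) ->
  bigjoin [set x : Q | x * x^* * x <= a] = a.
Proof.
move=> regular; apply/le_anti/andP; split.
  by apply: bigjoin_le => x /= xxa; exact: le_trans (regular x) xxa.
apply: partial_units_generate => t [tte _] ta; apply: le_bigjoin => /=.
exact: le_trans (mul_le_unitl _ e_unit tte) ta.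
Qed.

Variable s : Q -> Q.
Hypothesis s_supp : is_support e s.

Let regular x : x <= x * x^* * x := support_regular x s_supp.

(** The right-sided element [b 1] meets the units only in [b]: a part [w] of
    [e] below [b t], for a partial unit [t], satisfies
    [w <= w w^*], which is below [b t t^* b^*], hence below [b b^*] and [b]. *)
Lemma meet_unit_mul_top b : b <= e -> e `&` b * \top <= b.
Proof.
move=> be; rewrite -coverI mulg_bigjoinr.
apply: (join_preserving_bigjoin_le (meet_bigjoin e)) => _ [t It <-].
set w := e `&` b * t.
have wbt : w <= b * t by exact: leIr.
apply: le_trans (le_unit_mul_star e_unit (regular w) (leIl _ _)) _.
apply: le_trans (mulg_le wbt (le_star wbt)) _.
apply: le_trans (mul_partial_unit_star b b It) _.
by apply: mul_le_unitr e_unit _; rewrite -(star_unit e_unit) le_star.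
Qed.

(** The form in which stability of the support is needed.  The element
    [s(a 1)] is below [e] and below [a 1 a^* <= s(a) 1], and the only part of
    [e] below [s(a) 1] is [s(a)] itself. *)
Lemma support_mul_top a : s (a * \top) <= s a.
Proof.
have [_ s_e s_star s_mul] := s_supp.
apply: le_trans (meet_unit_mul_top (s_e a)); rewrite lexI s_e /=.
apply: le_trans (s_star _) _; rewrite -mulgA.
apply: le_trans (mulg_le2r _ (s_mul a)) _.
by rewrite -mulgA; apply/mulg_le2l/lex1.
Qed.

(** The element [z = a 1 /\ b] equals [s(z) z], and [s(z) <= s(a 1) <= s(a)]. *)
Lemma meet_mul_top a b : a * \top `&` b = s a * b.
Proof.
have [s_join s_e s_star s_mul] := s_supp.
apply/le_anti/andP; split; last first.
  rewrite lexI (mul_le_unitl _ e_unit) // andbT.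
  apply: le_trans (mulg_le2r _ (s_star a)) _.
  by rewrite -mulgA; apply/mulg_le2l/lex1.
apply: le_trans (s_mul _) _; apply: mulg_le; last exact: leIr.
by apply: le_trans (join_preserving_le s_join (leIl _ _)) (support_mul_top a).
Qed.

(** Applying the involution to [a 1 /\ b^* = s(a) b^*], where [s(a)] is
    self-adjoint. *)
Lemma meet_top_mul a b : b `&` \top * a^* = b * s a.
Proof.
have [_ s_e _ _] := s_supp.
rewrite -[b]starK -[\top * _]starK -star_meet starM starK star_top meetC.
by rewrite meet_mul_top starM (le_unit_star e_unit (regular _) (s_e a)).
Qed.

End InverseToOpen.

Theorem theorem2p58 (d : Order.disp_t) (Q : involutiveQuantalFrameType d) :
  unital_open_quantal_frame Q <-> inverse_quantal_frame Q.
Proof.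
split=> [[[_ upsilon_rs join_reg mul_meet] [e e_unit]] | [e [e_unit coverI [s s_supp]]]].
  exists e; split=> //; first exact: bigjoin_partial_units.
  exists (fun a => e `&` a * \top).
  exact: meet_unit_is_support (regular_of_bigjoin join_reg) mul_meet.
split; last by exists e.
have meetE := meet_mul_top e_unit coverI s_supp.
split=> [a b c|a|a|a b c].
- by rewrite meetE (meet_top_mul e_unit coverI s_supp) mulgA.
- exact: upsilon_right_sided e_unit coverI a.
- by apply: (bigjoin_mul_star_mul e_unit coverI) => x; exact: support_regular s_supp.
- by rewrite !meetE mulgA.
Qed.
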